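(* Let $(X,\mu)$ be a measure space with $X$ finite, i.e. $\dim L^2(X,\mu)=:N<\infty$, and let $A$ be a self-adjoint, negative semidefinite operator (with compact resolvent) on $L^2(X,\mu)$. Let $(\varphi_k)_{1\le k\le N}$ be an orthonormal basis of eigenvectors of $A$ with associated eigenvalues $(\lambda_k)_{1\le k\le N}$, and let $J_0:=\{k\in\{1,\ldots,N\}:\lambda_k=s(A)\}$. Then $(\mathrm{e}^{tA})_{t\ge 0}$ is asymptotically $\infty$-contractive if and only if $$\max_{1\le i\le N}\sum_{j=1}^N\left|\sum_{k\in J_0}(\varphi_k)_i(\varphi_k)_j\right|\le 1.$$
   Context: Here $s(A)$ denotes the spectral bound of $A$, i.e. its largest eigenvalue, and $(\varphi_k)_i$ denotes the $i$-th entry of $\varphi_k$, regarded as a vector with $N$ entries. Let $\mathbf 1$ be the constant function with value $1$, and let $[-\mathbf 1,\mathbf 1]$ be the unit order interval, i.e. the set of all $f$ with $|f|\le\mathbf 1$. The semigroup $(\mathrm{e}^{tA})_{t\ge 0}$ is called asymptotically $\infty$-contractive if $\mathrm{dist}(\mathrm{e}^{t(A-s(A))}f,[-\mathbf 1,\mathbf 1])\to 0$ as $t\to\infty$ for all $f$ with $|f|\le\mathbf 1$.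
   Formalization: For general μ the printed criterion is false (A = 0, all points of mass 1/2: the maximum is 2, but the semigroup is the identity); the j-th term is weighted by μ({j}) for every μ with positive finite point masses, and the printed formula is proved when every point has mass 1. *)

(* Defs.v *)
From HB Require Import structures.
From mathcomp Require Import all_boot all_order all_algebra.
From mathcomp Require Import all_classical all_reals all_analysis.
Set Implicit Arguments.
Unset Strict Implicit.
Unset Printing Implicit Defensive.
Import Order.TTheory GRing.Theory Num.Theory.
Import numFieldNormedType.Exports.
Local Open Scope classical_set_scope.
Local Open Scope ring_scope.

HB.instance Definition _ (n : nat) := isPointed.Build 'I_n.+1 ord0.
HB.instance Definition _ (n : nat) := @isMeasurable.Build default_measure_display
  'I_n.+1 (@discrete_measurable 'I_n.+1) (@discrete_measurable0 _)
  (@discrete_measurableC _) (@discrete_measurableU _).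

Section FiniteL2.
Context {R : realType} {n : nat}.
Implicit Types (mu : {measure set 'I_n.+1 -> \bar R}) (A M : 'M[R]_n.+1)
  (f g : 'cV[R]_n.+1).

(* X is 'I_n.+1 with all subsets measurable; scalars are real. Every point    *)
(* has finite positive mass, so L^2(X, mu) consists of all functions on X and *)
(* has dimension n.+1. A function is the column vector of its values, and an  *)
(* operator acts by left multiplication.                                      *)
Definition positive_finite_masses mu :=
  forall i : 'I_n.+1, (0 < mu [set i] < +oo)%E.

Definition mass mu (i : 'I_n.+1) : R := fine (mu [set i]).

Definition L2dot mu f g : R := Rintegral mu setT (fun i => f i 0 * g i 0).

Definition L2norm mu f : R := Num.sqrt (L2dot mu f f).

Definition self_adjoint mu A :=
  forall f g, L2dot mu (A *m f) g = L2dot mu f (A *m g).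

Definition negative_semidefinite mu A := forall f, L2dot mu (A *m f) f <= 0.

Definition eigenpair A (a : R) f := f != 0 /\ A *m f = a *: f.

(* The set is finite and nonempty when A has an eigenbasis: sup is a maximum. *)
Definition spectral_bound A : R := sup [set a : R | exists f, eigenpair A a f].

Definition orthonormal_eigenbasis mu A (phi : 'I_n.+1 -> 'cV[R]_n.+1)
    (lam : 'I_n.+1 -> R) :=
  [/\ basis_of fullv [tuple phi k | k < n.+1],
      forall k l, L2dot mu (phi k) (phi l) = (k == l)%:R &
      forall k, eigenpair A (lam k) (phi k)].

Definition top_indices A (lam : 'I_n.+1 -> R) : {set 'I_n.+1} :=
  [set k | lam k == spectral_bound A]%SET.

Definition expmx M : 'M[R]_n.+1 :=
  limn (series (fun k : nat => (k`!%:R)^-1 *: M ^+ k)).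

Definition unit_order_interval : set 'cV[R]_n.+1 :=
  [set f | forall i, `|f i 0| <= 1].

Definition L2dist mu f (C : set 'cV[R]_n.+1) : R :=
  inf [set L2norm mu (f - g) | g in C].

Definition asymptotically_infty_contractive mu A :=
  forall f, unit_order_interval f ->
    L2dist mu (expmx (t *: (A - (spectral_bound A)%:M)) *m f)
      unit_order_interval @[t --> +oo] --> (0 : R).

End FiniteL2.

(* Main.v *)
Require Import Defs.
From mathcomp Require Import all_boot all_order all_algebra.
From mathcomp Require Import all_classical all_reals all_analysis.
Import Order.TTheory GRing.Theory Num.Theory.
Import numFieldNormedType.Exports.
Local Open Scope classical_set_scope.
Local Open Scope ring_scope.
Set Implicit Arguments.
Unset Strict Implicit.
Unset Printing Implicit Defensive.

(** Write s for the spectral bound of A and Q_k f = <f, phi_k> phi_k for the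
    rank-one projection onto the line of phi_k.  Orthonormality says that the
    square matrices with columns phi_k and with rows (phi_k(j) mu_j)_j are
    inverse to each other in one order; being inverse in the other order is the
    resolution of the identity, sum_k Q_k = 1 ([sum_rank1_proj]).  As B Q_k is a
    multiple of Q_k for B = t (A - s), the exponential series of B splits into
    scalar series, and e^{t(A - s)} = sum_k e^{t(lam_k - s)} Q_k
    ([expmx_diagonalizable]).  Since lam_k <= s for every k, the terms with
    lam_k < s vanish as t grows, and e^{t(A - s)} f converges to P f, where P is
    the sum of the Q_k with lam_k = s ([cvg_rescaled_semigroup]).

    The unit order interval is closed, so the distance of e^{t(A - s)} f to it
    tends to 0 exactly when P f belongs to it ([cvg_L2dist0P]).  Hence the
    semigroup is asymptotically contractive if and only if P maps the unit order
    interval into itself, which for any matrix means that all its absolute row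
    sums are at most 1 ([stable_unit_order_intervalP]). *)

(** * The inner product in coordinates *)

Lemma mass_gt0 (R : realType) (n : nat) (mu : {measure set 'I_n.+1 -> \bar R})
    (i : 'I_n.+1) :
  positive_finite_masses mu -> 0 < mass mu i.
Proof. by move=> mu_masses; rewrite fine_gt0. Qed.

Lemma L2dotE (R : realType) (n : nat) (mu : {measure set 'I_n.+1 -> \bar R})
    (f g : 'cV[R]_n.+1) :
  positive_finite_masses mu ->
  L2dot mu f g = \sum_i f i 0 * g i 0 * mass mu i.
Proof.
move=> mu_masses; set h := fun i => f i 0 * g i 0.
have mT (B : set 'I_n.+1) : measurable B by [].
have TE : [set: 'I_n.+1] = \big[setU/set0]_(i <- index_enum 'I_n.+1) [set i].
  apply/seteqP; split=> [i _|//]; rewrite -bigcup_seq.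
  by exists i => //=; rewrite mem_index_enum.
rewrite /L2dot /Rintegral TE integral_bigsetU_EFin //=; first last.
- by apply/trivIsetP => i j _ _ /eqP ij; apply/seteqP; split=> x //= [-> /ij].
- exact: index_enum_uniq.
rewrite (eq_bigr (fun i => (h i * mass mu i)%:E)); first by rewrite sumEFin.
move=> i _; rewrite (eq_integral (cst (h i)%:E)) => [|x /set_mem -> //].
rewrite integral_cst // [RHS]EFinM /mass fineK // fin_numElt.
by have /andP[m0 ->] := mu_masses i; rewrite (lt_trans _ m0).
Qed.

(** * The exponential of an operator with a resolution of the identity *)

(** For a unit vector v this is the orthogonal projection f |-> <f, v> v; the
    weights of the inner product sit on the row vector. *)
Definition rank1_proj (R : realType) (n : nat)
    (mu : {measure set 'I_n.+1 -> \bar R}) (v : 'cV[R]_n.+1) : 'M[R]_n.+1 :=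
  v *m (\row_j (v j 0 * mass mu j)).

Lemma rank1_projE (R : realType) (n : nat)
    (mu : {measure set 'I_n.+1 -> \bar R}) (v : 'cV[R]_n.+1) i j :
  rank1_proj mu v i j = v i 0 * v j 0 * mass mu j.
Proof. by rewrite !mxE big_ord1 !mxE mulrA. Qed.

(** An orthonormal family of n.+1 vectors in dimension n.+1 is complete: a
    one-sided inverse of a square matrix is two-sided. *)
Lemma sum_rank1_proj (R : realType) (n : nat)
    (mu : {measure set 'I_n.+1 -> \bar R}) (phi : 'I_n.+1 -> 'cV[R]_n.+1) :
  positive_finite_masses mu ->
  (forall k l, L2dot mu (phi k) (phi l) = (k == l)%:R) ->
  \sum_k rank1_proj mu (phi k) = 1%:M.
Proof.
move=> mu_masses phi_on.
pose V := \matrix_(i, k) phi k i 0.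
pose W := \matrix_(k, j) (phi k j 0 * mass mu j).
(* W *m V is the Gram matrix of phi, and V *m W is the sum of the projections *)
have /mulmx1C <- : W *m V = 1%:M.
  apply/matrixP => k l; rewrite !mxE -phi_on L2dotE //.
  by apply: eq_bigr => i _; rewrite !mxE mulrAC.
apply/matrixP => i j; rewrite summxE mxE; apply: eq_bigr => k _.
by rewrite rank1_projE !mxE mulrA.
Qed.

Lemma mul_rank1_proj (R : realType) (n : nat)
    (mu : {measure set 'I_n.+1 -> \bar R}) (M : 'M[R]_n.+1) a v :
  M *m v = a *: v -> M *m rank1_proj mu v = a *: rank1_proj mu v.
Proof. by move=> Mv; rewrite mulmxA Mv scalemxAl. Qed.

Lemma cvg_fsum {T : Type} {F : set_system T} {FF : Filter F}
    {R : realType} {V : normedModType R} {I : finType} (P : pred I)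
    (u : I -> T -> V) (l : I -> V) :
  (forall i, P i -> u i x @[x --> F] --> l i) ->
  \sum_(i | P i) u i x @[x --> F] --> \sum_(i | P i) l i.
Proof. by move=> ul; apply: cvg_big => //; exact: add_continuous. Qed.

(** Each power satisfies M ^ m = M ^ m * sum_k Q_k = sum_k a_k ^ m Q_k, so the
    partial sums of the matrix exponential are combinations of the fixed
    matrices Q_k with partial sums of e^{a_k} as coefficients; convergence of
    the matrix series is thereby reduced to the scalar one. *)
Lemma expmx_diagonalizable (R : realType) (n : nat) (I : finType)
    (M : 'M[R]_n.+1) (Q : I -> 'M[R]_n.+1) (a : I -> R) :
  \sum_k Q k = 1%:M -> (forall k, M *m Q k = a k *: Q k) ->
  expmx M = \sum_k expR (a k) *: Q k.
Proof.
move=> Q1 MQ.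
have MXQ m k : M ^+ m *m Q k = a k ^+ m *: Q k.
  elim: m => [|m IH]; first by rewrite !expr0 mul1mx scale1r.
  by rewrite exprSr -mulmxA MQ -scalemxAr IH scalerA -exprS.
apply/cvg_lim => //.
have -> : series (fun m : nat => (m`!%:R)^-1 *: M ^+ m) =
    fun N => \sum_k series (exp_coeff (a k)) N *: Q k.
  apply/funext => N; rewrite /series /=.
  under [RHS]eq_bigr do rewrite scaler_suml.
  rewrite exchange_big; apply: eq_bigr => m _ /=.
  rewrite -[M ^+ m]mulmx1 -Q1 mulmx_sumr scaler_sumr.
  by apply: eq_bigr => k _; rewrite MXQ scalerA /exp_coeff /= mulrC.
apply: cvg_fsum => k _; apply: cvgZr_tmp.
exact: is_cvg_series_exp_coeff.
Qed.

(** * The spectral bound *)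

(** The spectral bound is a supremum, which dominates the eigenvalues only
    because their set is bounded above: by 0, since a <f, f> = <A f, f> <= 0
    for an eigenpair (a, f) and the inner product is definite. *)
Lemma eigenvalue_le_spectral_bound (R : realType) (n : nat)
    (mu : {measure set 'I_n.+1 -> \bar R}) (A : 'M[R]_n.+1) a v :
  positive_finite_masses mu -> negative_semidefinite mu A ->
  eigenpair A a v -> a <= spectral_bound A.
Proof.
move=> mu_masses A_nsd Aav; apply: ub_le_sup; last by exists v.
exists 0 => b [f [f0 Af]].
have := A_nsd f; rewrite Af L2dotE // => le0; rewrite leNgt; apply/negP => b0.
have mass0 i := mass_gt0 i mu_masses.
have nonneg i : 0 <= (b *: f) i 0 * f i 0 * mass mu i.
  rewrite mxE -mulrA -mulrA mulr_ge0 ?(ltW b0) //.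
  by rewrite mulrA mulr_ge0 -?expr2 ?sqr_ge0 ?ltW.
move: f0; apply/negP; rewrite negbK; apply/eqP/matrixP => i j; rewrite ord1 mxE.
have /eqP : \sum_i (b *: f) i 0 * f i 0 * mass mu i == 0.
  by rewrite eq_le le0 sumr_ge0.
move=> /psumr_eq0P => /(_ (fun i _ => nonneg i) i isT) /eqP.
by rewrite mxE !mulf_eq0 (gt_eqF b0) (gt_eqF (mass0 i)) /= orbF orbb => /eqP.
Qed.

(** * Distance to the unit order interval *)

Lemma cvg_L2norm0 (R : realType) (n : nat)
    (mu : {measure set 'I_n.+1 -> \bar R}) (T : Type)
    (F : set_system T) {FF : Filter F}
    (u : T -> 'cV[R]_n.+1) (p : 'cV[R]_n.+1) :
  positive_finite_masses mu ->
  u t @[t --> F] --> p -> L2norm mu (u t - p) @[t --> F] --> (0 : R).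
Proof.
move=> mu_masses up; rewrite -sqrtr0 /L2norm.
suff dot0 : L2dot mu (u t - p) (u t - p) @[t --> F] --> (0 : R).
  exact: (cvg_comp (fun t => L2dot mu (u t - p) (u t - p)) Num.sqrt dot0
    (@sqrt_continuous R 0)).
rewrite [X in _ --> X](_ : _ = \sum_(i < n.+1) 0 * 0 * mass mu i); last first.
  by rewrite big1 // => i _; rewrite !mul0r.
under eq_fun do rewrite L2dotE //.
apply: cvg_fsum => i _; apply: cvgMr_tmp.
suff ui : (u t - p) i 0 @[t --> F] --> (0 : R) by exact: cvgM.
rewrite -(subrr (p i 0)).
under eq_fun do rewrite mxE [(- p) _ _]mxE.
apply: cvgB; last exact: cvg_cst.
exact: (cvg_comp _ _ up (@coord_continuous _ _ _ i 0 p)).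
Qed.

(** A single coordinate bounds the distance from below: every g in the interval
    has |g_i| <= 1, hence |f_i - g_i| >= |f_i| - 1, and the norm of f - g is at
    least the contribution of the point i. *)
Lemma L2dist_ge (R : realType) (n : nat)
    (mu : {measure set 'I_n.+1 -> \bar R}) (f : 'cV[R]_n.+1) i :
  positive_finite_masses mu ->
  Num.sqrt (mass mu i) * (`|f i 0| - 1) <= L2dist mu f unit_order_interval.
Proof.
move=> mu_masses; apply: lb_le_inf.
  by exists (L2norm mu (f - 0)), 0 => // j; rewrite mxE normr0.
have mass0 j := ltW (mass_gt0 j mu_masses).
move=> _ [g g1 <-].
apply: (@le_trans _ _ (Num.sqrt (mass mu i) * `|f i 0 - g i 0|)).
  rewrite ler_wpM2l ?sqrtr_ge0 //.
  apply: le_trans (lerB_dist _ _).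
  by rewrite lerD2l lerN2.
rewrite -sqrtr_sqr -sqrtrM // ler_wsqrtr // L2dotE //.
rewrite (bigD1 i) //= mulrC !mxE expr2 lerDl sumr_ge0 // => j _.
by rewrite mulr_ge0 // -expr2 sqr_ge0.
Qed.

Lemma L2dist_le (R : realType) (n : nat)
    (mu : {measure set 'I_n.+1 -> \bar R}) (f g : 'cV[R]_n.+1) C :
  C g -> L2dist mu f C <= L2norm mu (f - g).
Proof.
move=> Cg; apply: ge_inf; last by exists g.
by exists 0 => _ [h _ <-]; rewrite sqrtr_ge0.
Qed.

Lemma L2dist_ge0 (R : realType) (n : nat)
    (mu : {measure set 'I_n.+1 -> \bar R}) (f : 'cV[R]_n.+1) C :
  C !=set0 -> 0 <= L2dist mu f C.
Proof.
move=> [g Cg]; apply: lb_le_inf; first by exists (L2norm mu (f - g)), g.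
by move=> _ [h _ <-]; rewrite sqrtr_ge0.
Qed.

(** The distance of the trajectory to the interval is at most its distance to p
    when p is in the interval.  Conversely the bounds of [L2dist_ge] pass to the
    limit and give |p_i| - 1 <= 0 for every i. *)
Lemma cvg_L2dist0P (R : realType) (n : nat)
    (mu : {measure set 'I_n.+1 -> \bar R}) (T : topologicalType)
    (F : set_system T) {FF : ProperFilter F}
    (u : T -> 'cV[R]_n.+1) (p : 'cV[R]_n.+1) :
  positive_finite_masses mu -> u t @[t --> F] --> p ->
  (L2dist mu (u t) unit_order_interval @[t --> F] --> (0 : R)) <->
  unit_order_interval p.
Proof.
move=> mu_masses up; split=> [d0 i|Cp].
  have mass0 : 0 < Num.sqrt (mass mu i) by rewrite sqrtr_gt0 mass_gt0.
  rewrite -subr_le0 -(pmulr_rle0 _ mass0).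
  apply: ler_cvg_to d0 _; last first.
    by apply: nearW => t; exact: L2dist_ge.
  apply: cvgMl_tmp; apply: cvgB; last exact: cvg_cst.
  apply: cvg_norm.
  exact: (cvg_comp _ _ up (@coord_continuous _ _ _ i 0 p)).
apply: (squeeze_cvgr _ (cvg_cst 0) (cvg_L2norm0 mu_masses up)).
by apply: nearW => t; rewrite L2dist_le // L2dist_ge0 //; exists p.
Qed.

(** The operator norm for the sup norm is the largest absolute row sum: the i-th
    row sum is attained on the vector of signs of the i-th row. *)
Lemma stable_unit_order_intervalP (R : realType) (n : nat) (P : 'M[R]_n.+1) :
  (forall f, unit_order_interval f -> unit_order_interval (P *m f)) <->
  \big[Num.max/0]_(i < n.+1) \sum_(j < n.+1) `|P i j| <= 1.
Proof.
split=> [stable|/bigmax_leP[_ rows] f f1 i].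
  apply/bigmax_leP; split=> // i _.
  have /(_ i) : unit_order_interval (P *m \col_j Num.sg (P i j)).
    apply: stable => j; rewrite mxE normr_sg.
    by case: (_ != _); rewrite ?ler01 // lexx.
  rewrite mxE (eq_bigr (fun j => `|P i j|)) => [|j _].
    exact: le_trans (ler_norm _).
  by rewrite mxE mulrC -normrEsg.
rewrite mxE; apply: le_trans (ler_norm_sum _ _ _) (le_trans _ (rows i isT)).
by apply: ler_sum => j _; rewrite normrM ler_piMr.
Qed.

(** * Convergence of the rescaled semigroup *)

Lemma cvg_expR_mul_neg (R : realType) (b : R) :
  b < 0 -> expR (t * b) @[t --> +oo] --> (0 : R).
Proof.
move=> b0; have bt : t * - b @[t --> +oo] --> +oo.
  by apply: gt0_cvgMly; rewrite ?oppr_gt0 //; exact: cvg_id.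
have -> : (fun t => expR (t * b)) = (fun x => expR (- x)) \o (fun t => t * - b).
  by apply/funext => t /=; rewrite mulrN opprK.
exact: cvg_comp bt (@cvgr_expR R).
Qed.

(** The orthogonal projection onto the eigenspace of the spectral bound, when
    phi is an orthonormal eigenbasis of A with eigenvalues lam. *)
Definition top_proj (R : realType) (n : nat)
    (mu : {measure set 'I_n.+1 -> \bar R}) (A : 'M[R]_n.+1)
    (phi : 'I_n.+1 -> 'cV[R]_n.+1) (lam : 'I_n.+1 -> R) : 'M[R]_n.+1 :=
  \sum_(k in top_indices A lam) rank1_proj mu (phi k).

Lemma top_projE (R : realType) (n : nat)
    (mu : {measure set 'I_n.+1 -> \bar R}) (A : 'M[R]_n.+1)
    (phi : 'I_n.+1 -> 'cV[R]_n.+1) (lam : 'I_n.+1 -> R) i j :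
  top_proj mu A phi lam i j =
  (\sum_(k in top_indices A lam) phi k i 0 * phi k j 0) * mass mu j.
Proof.
rewrite summxE mulr_suml.
by apply: eq_bigr => k _; rewrite rank1_projE.
Qed.

(** In the spectral decomposition the coefficient e^{t(lam_k - s)} is 1 when
    lam_k = s and tends to 0 otherwise, as then lam_k < s. *)
Lemma cvg_rescaled_semigroup (R : realType) (n : nat)
    (mu : {measure set 'I_n.+1 -> \bar R}) (A : 'M[R]_n.+1)
    (phi : 'I_n.+1 -> 'cV[R]_n.+1) (lam : 'I_n.+1 -> R) (f : 'cV[R]_n.+1) :
  positive_finite_masses mu -> negative_semidefinite mu A ->
  orthonormal_eigenbasis mu A phi lam ->
  expmx (t *: (A - (spectral_bound A)%:M)) *m f @[t --> +oo] -->
  top_proj mu A phi lam *m f.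
Proof.
move=> mu_masses A_nsd [_ phi_on phi_eig]; set s := spectral_bound A.
have semigroupE t : expmx (t *: (A - s%:M)) *m f =
    \sum_k expR (t * (lam k - s)) *: (rank1_proj mu (phi k) *m f).
  rewrite (expmx_diagonalizable (sum_rank1_proj mu_masses phi_on)
    (a := fun k => t * (lam k - s))) => [|k].
    by rewrite mulmx_suml; apply: eq_bigr => k _; rewrite scalemxAl.
  apply: mul_rank1_proj.
  by rewrite -scalemxAl mulmxBl (phi_eig k).2 mul_scalar_mx -scalerBl scalerA.
rewrite /top_proj mulmx_suml big_mkcond /=.
under eq_fun do rewrite semigroupE.
apply: cvg_fsum => k _.
rewrite inE -/s; have [->|lam_s] := eqVneq (lam k) s.
  by under eq_fun do rewrite subrr mulr0 expR0 scale1r; exact: cvg_cst.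
rewrite -[X in _ --> X](scale0r (rank1_proj mu (phi k) *m f)).
apply: cvgZr_tmp; apply: cvg_expR_mul_neg; rewrite subr_lt0 lt_neqAle lam_s.
exact: eigenvalue_le_spectral_bound mu_masses A_nsd (phi_eig k).
Qed.

(** * Asymptotic contractivity *)

(* In the value coordinates the projection onto the top eigenspace has the     *)
(* matrix (sum_k phi_k(i) phi_k(j) mu_j)_(i, j), whence the weights mass mu j; *)
(* they disappear when mu is the counting measure, i.e. L^2(X, mu) = R^N.      *)
(* All row sums are nonnegative, so the 0 in Num.max does not affect the max.  *)
Theorem corollary4p14 (R : realType) (n : nat)
    (mu : {measure set 'I_n.+1 -> \bar R}) (A : 'M[R]_n.+1)
    (phi : 'I_n.+1 -> 'cV[R]_n.+1) (lam : 'I_n.+1 -> R)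
    (mu_masses : positive_finite_masses mu)
    (A_sa : self_adjoint mu A)
    (A_nsd : negative_semidefinite mu A)
    (phi_basis : orthonormal_eigenbasis mu A phi lam) :
  (asymptotically_infty_contractive mu A <->
    \big[Num.max/0]_(i < n.+1) \sum_(j < n.+1)
      `|\sum_(k in top_indices A lam) phi k i 0 * phi k j 0| * mass mu j <= 1)
  /\
  ((forall i, mu [set i] = 1%E) ->
    (asymptotically_infty_contractive mu A <->
      \big[Num.max/0]_(i < n.+1) \sum_(j < n.+1)
        `|\sum_(k in top_indices A lam) phi k i 0 * phi k j 0| <= 1)).
Proof.
have weighted : asymptotically_infty_contractive mu A <->
    \big[Num.max/0]_(i < n.+1) \sum_(j < n.+1)
      `|\sum_(k in top_indices A lam) phi k i 0 * phi k j 0| * mass mu j <= 1.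
  rewrite (eq_bigr (fun i => \sum_j `|top_proj mu A phi lam i j|)); last first.
    move=> i _; apply: eq_bigr => j _; rewrite top_projE normrM.
    by rewrite [X in _ = _ * X]ger0_norm // ltW // mass_gt0.
  rewrite -stable_unit_order_intervalP.
  have dist0P f := cvg_L2dist0P mu_masses
    (cvg_rescaled_semigroup (f := f) mu_masses A_nsd phi_basis).
  by split=> H f f1; apply/dist0P; exact: H.
split=> // mu1; rewrite weighted.
under eq_bigr do under eq_bigr do rewrite /mass mu1 mulr1.
by [].
Qed.
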